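(* For Lebesgue-almost every real number $\alpha$, the series $\sum_{n \geq 1} n^{-3} \|n\alpha\|^{-2}$ converges. Equivalently, for Lebesgue-almost every real number $\alpha$, the series $\sum_{n \geq 1} n^{-3} \sin^{-2}(\pi n \alpha)$ converges.
   Context: For a real number $x$, $\|x\|$ denotes the distance from $x$ to the nearest integer. Here $\sin^{-2}(x)$ means $1/(\sin x)^2$. The terms of both series are defined for every irrational $\alpha$. *)

(* Defs.v *)
From HB Require Import structures.
From mathcomp Require Import all_boot all_order all_algebra.
From mathcomp Require Import all_classical all_reals all_analysis.

Set Implicit Arguments.
Unset Strict Implicit.
Unset Printing Implicit Defensive.

Import Order.TTheory GRing.Theory Num.Theory.
Import numFieldNormedType.Exports.

Local Open Scope classical_set_scope.
Local Open Scope ring_scope.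

Definition dist_int (R : realType) (x : R) : R :=
  inf [set `|x - m%:~R| | m in [set: int]].

(* Main.v *)
Require Import Defs.
From HB Require Import structures.
From mathcomp Require Import all_boot all_order all_algebra.
From mathcomp Require Import all_classical all_reals all_analysis.
From mathcomp Require Import measurable_realfun.
From mathcomp Require Import ring lra.

Set Implicit Arguments.
Unset Strict Implicit.
Unset Printing Implicit Defensive.

Import Order.TTheory GRing.Theory Num.Theory.
Import numFieldNormedType.Exports.

Local Open Scope classical_set_scope.
Local Open Scope ring_scope.

(** Write [f_n] for the function [alpha |-> n^-3 ||n alpha||^-2]. It is not
    integrable on an interval, because of its poles at the fractions with
    denominator [n], but it is so in the weak sense: [f_n > 4^-k] means that
    [||n alpha|| < 2^k n^(-3/2)], which on an interval of length 1 happens on at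
    most [n + 1] balls of radius [2^k n^(-5/2)] ([mem_resonance]), a set of
    measure at most [4 * 2^k n^(-3/2)] ([lebesgue_measure_resonance_le]).

    Slice the truncation [min 1 f_n] along the levels [4^-k]. The weight [4^-k]
    of a level outweighs the factor [2^k] in its measure, so [min 1 f_n] has
    integral [O(n^(-3/2))], which is summable. By monotone convergence the
    series of the [min 1 f_n] is finite almost everywhere; its terms then tend
    to 0, so all but finitely many of them are equal to [f_n], and the series of
    the [f_n] converges ([ae_cvg_series_weak_type]).

    The series with sines is dominated term by term, because
    [|sin (pi x)| >= ||x||] ([sin_pi_inv_sqr_le]). *)

(** * Almost everywhere convergence from a weak-type bound *)

(** A series dominated by telescoping differences of a nonnegative sequence is at
    most the first term of that sequence. Serves both for the sum over the dyadic
    layers and for the sum of the (n+1)^(-3/2). *)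
Lemma nneseries_le_telescope (R : realType) (u t : nat -> R) :
  (forall n, 0 <= u n) -> (forall n, 0 <= t n) ->
  (forall n, u n <= t n - t n.+1) ->
  (\sum_(n <oo) (u n)%:E <= (t 0)%:E)%E.
Proof.
move=> u0 t0 ut; apply: lime_le.
  by apply: is_cvg_nneseries => n _ _; rewrite lee_fin.
apply: nearW => N; rewrite sumEFin lee_fin.
apply: (@le_trans _ _ (t 0 - t N)); last by rewrite gerBl.
rewrite -[leRHS]opprB -telescope_sumr // -sumrN; apply: ler_sum => n _.
by rewrite opprB.
Qed.

Lemma ae_fin_nneseries d (T : measurableType d) (R : realType)
    (mu : {measure set T -> \bar R}) (g : nat -> T -> \bar R) :
  (forall n, measurable_fun setT (g n)) -> (forall n x, (0 <= g n x)%E) ->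
  (\sum_(n <oo) \int[mu]_x g n x < +oo)%E ->
  {ae mu, forall x, (\sum_(n <oo) g n x < +oo)%E}.
Proof.
move=> mg g0 goo.
have s0 x : (0 <= \sum_(n <oo) g n x)%E by apply: nneseries_ge0.
have ig : mu.-integrable setT (fun x => \sum_(n <oo) g n x)%E.
  apply/integrableP; split; first exact: ge0_emeasurable_sum.
  by under eq_integral do rewrite gee0_abs //; rewrite integral_nneseries.
have := integrable_ae measurableT ig.
by apply: filterS => x /(_ I); rewrite ge0_fin_numE.
Qed.

(** Truncating the terms at 1 does not change convergence: a convergent series
    has terms tending to 0, so from some index on the truncation is void. This is
    what makes the argument insensitive to the terms failing to be integrable. *)
Lemma cvg_series_eventually_min (R : realType) (f : nat -> R)
    (g : nat -> \bar R) :
  (forall n, 0 <= f n) -> (forall n, (0 <= g n)%E) ->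
  (forall n, ((Num.min 1 (f n))%:E <= g n)%E) ->
  (\sum_(n <oo) g n < +oo)%E -> cvgn (series f).
Proof.
move=> f0 g0 fg goo.
pose v n : R := Num.min 1 (f n).
have v0 n : 0 <= v n by rewrite le_min ler01 f0.
have gfin : (\sum_(n <oo) g n)%E \is a fin_num.
  by rewrite ge0_fin_numE // nneseries_ge0.
have vcvg : cvgn (series v).
  apply: nondecreasing_is_cvgn; first exact: nondecreasing_series.
  exists (fine (\sum_(n <oo) g n)%E) => _ [N _ <-].
  rewrite -lee_fin fineK // -sumEFin.
  apply: (@le_trans _ _ (\sum_(0 <= n < N) g n)%E).
    by apply: lee_sum => n _; exact: fg.
  exact: nneseries_lim_ge.
have [N _ Nv] : \forall n \near \oo, v n < 1.
  exact: cvgr_lt (cvg_series_cvg_0 vcvg) _ ltr01.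
rewrite -(is_cvg_series_restrict N).
have fv n : (N <= n)%N -> f n = v n.
  by move=> /Nv; rewrite /v /= /Num.min; case: ifP => // _; rewrite ltxx.
have -> : (fun n => \sum_(N <= k < n) f k) = (fun n => \sum_(N <= k < n) v k).
  by apply/funext => n; apply: eq_big_nat => k /andP[/fv].
by rewrite is_cvg_series_restrict.
Qed.

(** A weak-type bound suffices for almost everywhere convergence. In the
    application [A n k] contains [{f n > 4^-(k+1)}], a set whose measure grows
    only like 2^k; the weights 4^-k beat this growth, so that
    [min 1 (f n) <= \sum_k 4^-k * \1_(A n k)] has integral at most [2 * s n]. *)
Lemma ae_cvg_series_weak_type d (T : measurableType d) (R : realType)
    (mu : {measure set T -> \bar R}) (D : set T) (f : nat -> T -> R)
    (s : nat -> R) (A : nat -> nat -> set T) :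
  (forall n x, 0 <= f n x) -> (forall n, 0 <= s n) ->
  (\sum_(n <oo) (s n)%:E < +oo)%E ->
  (forall n k, measurable (A n k)) ->
  (forall n k, (mu (A n k) <= (2 ^+ k * s n)%:E)%E) ->
  (forall n x, D x -> exists2 k, A n k x & Num.min 1 (f n x) <= 4 ^- k) ->
  {ae mu, forall x, D x -> cvgn (series (f ^~ x))}.
Proof.
move=> f0 s0 soo mA muA Af.
pose h n k x : \bar R := ((4 ^- k)%:E * (\1_(A n k) x)%:E)%E.
pose g n x : \bar R := (\sum_(k <oo) h n k x)%E.
have p40 k : 0 <= 4 ^- k :> R by rewrite invr_ge0 exprn_ge0.
have h0 n k x : (0 <= h n k x)%E by rewrite /h -EFinM lee_fin mulr_ge0.
have g0 n x : (0 <= g n x)%E by apply: nneseries_ge0.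
have m1 n k : measurable_fun setT (fun x => (\1_(A n k) x)%:E : \bar R).
  by apply/measurable_EFinP; exact: measurable_indic.
have mh n k : measurable_fun setT (h n k) by exact: measurable_funeM.
have mg n : measurable_fun setT (g n) by exact: ge0_emeasurable_sum.
have ig n : (\int[mu]_x g n x <= (2 * s n)%:E)%E.
  rewrite integral_nneseries //.
  (* 2 = 1 + 1/2 + 1/4 + ... is the first term of the telescoping 2 * 2^-k. *)
  have -> : 2 * s n = 2 * (2^-1) ^+ 0 * s n by rewrite expr0 mulr1.
  apply: le_trans; last first.
    apply: (@nneseries_le_telescope _ (fun k => (2^-1) ^+ k * s n)
                                      (fun k => 2 * (2^-1) ^+ k * s n)).
    - by move=> k; rewrite mulr_ge0 // exprn_ge0.
    - by move=> k; rewrite !mulr_ge0 // exprn_ge0.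
    - by move=> k; rewrite exprS -mulrBl; apply: ler_wpM2r => //; lra.
  apply: lee_nneseries => [k _ _ | k _].
    by apply: integral_ge0 => x _; exact: h0.
  rewrite ge0_integralZl_EFin //.
  rewrite integral_indic // setIT.
  apply: (le_trans (lee_wpmul2l _ (muA n k))); first by rewrite lee_fin.
  rewrite -EFinM lee_fin mulrA.
  suff -> : 4 ^- k * 2 ^+ k = 2^-1 ^+ k :> R by [].
  by rewrite -exprVn -exprMn; congr (_ ^+ k); lra.
have gsum : (\sum_(n <oo) \int[mu]_x g n x < +oo)%E.
  apply: (@le_lt_trans _ _ (\sum_(n <oo) (2%:E * (s n)%:E))%E).
    apply: lee_nneseries => [n _ _ | n _]; last by rewrite -EFinM.
    by apply: integral_ge0 => x _; exact: g0.
  rewrite nneseriesZl => [|n _]; last by rewrite lee_fin.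
  by apply: lte_mul_pinfty; rewrite ?lee_fin.
have := ae_fin_nneseries mg g0 gsum.
apply: filterS => x gx Dx; apply: cvg_series_eventually_min gx => // n.
have [k Ax fk] := Af n x Dx.
apply: (@le_trans _ _ (h n k x)).
  by rewrite /h indicE mem_set // mule1 lee_fin.
apply: le_trans (@nneseries_lim_ge _ (h n ^~ x) xpredT 0 k.+1 _) => //.
by rewrite big_nat_recr //= leeDr // sume_ge0.
Qed.

(** * Distance to the nearest integer *)

Lemma dist_int_le (R : realType) (x : R) (m : int) :
  dist_int x <= `|x - m%:~R|.
Proof. by apply: ge_inf; [exists 0 => _ [k _ <-] | exists m]. Qed.

(** Any other integer lies on the far side of the floor or of its successor, hence
    the infimum is a minimum over these two. The location of the minimizer is what
    bounds the number of balls in [resonance] below. *)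
Lemma dist_int_attained (R : realType) (x : R) :
  exists2 m : int, Num.floor x <= m <= Num.floor x + 1 &
    dist_int x = `|x - m%:~R|.
Proof.
have /andP[] := floor_itv x; set l := Num.floor x; rewrite intrD => lx xl.
have lb (m : int) : `|x - l%:~R| <= `|x - m%:~R| \/
                    `|x - (l + 1)%:~R| <= `|x - m%:~R|.
  have [ml|] := leP m l.
    have ml' : (m%:~R : R) <= l%:~R by rewrite ler_int.
    by left; rewrite !ger0_norm ?subr_ge0 //; lra.
  rewrite -lezD1 -(ler_int R) => lm; right.
  by rewrite !ler0_norm ?subr_le0 ?intrD; lra.
have [c|c] := leP `|x - l%:~R| `|x - (l + 1)%:~R|.
  exists l; first by rewrite lexx lerDl.
  apply/eqP; rewrite eq_le dist_int_le /=.
  apply: lb_le_inf; first by exists `|x - 0%:~R|, 0.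
  by move=> _ [m _ <-]; have [//|] := lb m; exact: le_trans.
exists (l + 1); first by rewrite lexx lerDl.
apply/eqP; rewrite eq_le dist_int_le /=.
apply: lb_le_inf; first by exists `|x - 0%:~R|, 0.
by move=> _ [m _ <-]; have [|//] := lb m; exact/le_trans/ltW.
Qed.

Lemma dist_int_ge0 (R : realType) (x : R) : 0 <= dist_int x.
Proof. by have [m _ ->] := dist_int_attained x. Qed.

Lemma dist_int_le_half (R : realType) (x : R) : dist_int x <= 2^-1.
Proof.
have /andP[] := floor_itv x; rewrite intrD => lx xl.
have := dist_int_le x (Num.floor x); rewrite ger0_norm ?subr_ge0 // => d0.
have := dist_int_le x (Num.floor x + 1).
rewrite intrD ler0_norm ?subr_le0 ?(ltW xl) //; lra.
Qed.

(** * Points close to fractions with a given denominator *)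

(** The points within [r / n] of a fraction with denominator [n] in the interval
    from [j] to [j + 1]. Working with this explicit union of balls, rather than
    with the set where [dist_int (n%:R * x) < r], makes measurability and the
    measure bound immediate. *)
Definition resonance (R : realType) (j : int) (n : nat) (r : R) : set R :=
  \big[setU/set0]_(i < n.+1) ball ((n%:Z * j + i%:Z)%:~R / n%:R : R) (r / n%:R).

Lemma measurable_resonance (R : realType) j n (r : R) :
  measurable (resonance j n r).
Proof. by apply: bigsetU_measurable => i _; exact: measurable_ball. Qed.

(** There are n + 1 balls of length 2 r / n each, and 2 (n + 1) / n <= 4: the
    bound does not depend on n. *)
Lemma lebesgue_measure_resonance_le (R : realType) j n (r : R) :
  (0 < n)%N -> 0 <= r ->
  (lebesgue_measure (resonance j n r) <= (4 * r)%:E)%E.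
Proof.
move=> n0 r0.
pose B i : set R := ball ((n%:Z * j + i%:Z)%:~R / n%:R : R) (r / n%:R).
have rn : 0 <= r / n%:R by rewrite divr_ge0.
apply: (le_trans (@Boole_inequality _ _ _ lebesgue_measure B _ _)).
  by move=> i _; exact: measurable_ball.
have muB i : lebesgue_measure (B i) = (r / n%:R *+ 2)%:E.
  exact: lebesgue_measure_ball.
rewrite (eq_bigr (fun=> (r / n%:R *+ 2)%:E)) => [|i _]; last exact: muB.
rewrite sumEFin lee_fin sumr_const card_ord -mulrnA -[leLHS]mulr_natr.
have nR : (1 : R) <= n%:R by rewrite ler1n.
rewrite natrM -[n.+1]addn1 natrD -subr_ge0.
have -> : 4 * r - r / n%:R * (2 * (n%:R + 1)) = 2 * r * ((n%:R - 1) / n%:R).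
  by field; rewrite pnatr_eq0 -lt0n.
by rewrite !mulr_ge0 ?invr_ge0 ?subr_ge0.
Qed.

Lemma mem_resonance (R : realType) (j : int) n (r x : R) :
  (0 < n)%N -> j%:~R <= x < (j + 1)%:~R -> dist_int (n%:R * x) < r ->
  resonance j n r x.
Proof.
move=> n0 /andP[jx]; rewrite intrD => xj.
have nR : (0 : R) < n%:R by rewrite ltr0n.
have [m /andP[lm ml] ->] := dist_int_attained (n%:R * x).
have jm : n%:Z * j <= m.
  apply: le_trans lm; rewrite floor_ge_int intrM ler_pM2l //.
have mj : m <= n%:Z * j + n%:Z.
  apply: (le_trans ml); rewrite lezD1 floor_lt_int intrD intrM.
  by rewrite -[X in _ + X]mulr1 -mulrDr ltr_pM2l.
move=> mr; rewrite /resonance.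
rewrite -(bigcup_mkord _ (fun i => ball ((n%:Z * j + i%:Z)%:~R / n%:R : R) _)).
exists (absz (m - n%:Z * j)%R).
  by rewrite /= ltnS -lez_nat gez0_abs ?subr_ge0 // lerBlDl.
rewrite /ball /= gez0_abs ?subr_ge0 // [X in X%:~R]addrC subrK distrC.
rewrite ltr_pdivlMr // -[X in _ * X]gtr0_norm // -normrM mulrBl.
by rewrite divfK ?gt_eqF // [x * _]mulrC.
Qed.

(** [k] is the least exponent with [x < 2^(k+1) s]. For [k > 0] minimality gives
    [2^k s <= x], which bounds the quotient; for [k = 0] the truncation at 1 does,
    which covers [x = 0] too. *)
Lemma dyadic_layer (R : realType) (x s : R) : 0 <= x -> 0 < s ->
  exists2 k, x < 2 ^+ k.+1 * s & Num.min 1 (s ^+ 2 / x ^+ 2) <= 4 ^- k.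
Proof.
move=> x0 s0.
have ex : exists k, x < 2 ^+ k.+1 * s.
  exists (Num.truncn (x / s)); rewrite -ltr_pdivrMr //.
  apply: (lt_le_trans (truncnS_gt _)); rewrite -natrX ler_nat ltnW //.
  exact: ltn_expl.
case: (ex_minnP ex) => -[|k] xk kmin.
  by exists 0%N; rewrite // expr0 invr1 ge_min lexx.
exists k.+1 => //.
have kx : 2 ^+ k.+1 * s <= x.
  by rewrite leNgt; apply/negP => /kmin; rewrite ltnn.
have y0 : 0 < 2 ^+ k.+1 * s by rewrite mulr_gt0 // exprn_gt0.
have xp : 0 < x by apply: lt_le_trans kx.
rewrite ge_min; apply/orP; right.
have -> : 4 = 2 ^+ 2 :> R by rewrite -natrX.
rewrite -expr_div_n -exprM mulnC exprM -exprVn.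
rewrite ler_pXn2r ?nnegrE ?divr_ge0 ?invr_ge0 ?exprn_ge0 ?(ltW s0) //.
by rewrite ler_pdivrMr // mulrC ler_pdivlMr ?exprn_gt0 // mulrC.
Qed.

(** * Comparison of the sine with the distance to the nearest integer *)

(** With z = y / 2, the mean value theorem gives [sin z >= z cos z], whence
    [sin y = 2 sin z cos z >= y cos^2 z = y (1 + cos y) / 2 >= y / 2]. *)
Lemma le_half_sin (R : realType) (y : R) : 0 <= y <= pi / 2 -> y / 2 <= sin y.
Proof.
move=> /andP[y0 ypi]; pose z := y / 2.
have pi2 := pi_ge2 R.
have z0 : 0 <= z by rewrite divr_ge0.
have [c /[!in_itv]/= /andP[c0 cz]] : exists2 c, c \in `[0, z] &
    sin z - sin 0 = cos c * (z - 0).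
  by apply: MVT_segment => //; apply: continuous_subspaceT; exact: continuous_sin.
rewrite sin0 !subr0 => sinz.
have zpi : z <= pi by rewrite /z; lra.
have cosz : cos z <= cos c.
  by rewrite leNgt ltr_cos ?in_itv /= ?c0 ?z0 //= -?leNgt ?(le_trans cz).
have cosy : 0 <= cos y by apply: cos_ge0_pihalf; lra.
have yz : y = z *+ 2 by rewrite /z; lra.
have cz0 : 0 <= cos z by apply: cos_ge0_pihalf; rewrite /z; lra.
move: cosy; rewrite yz sin_mulr2n cos_mulr2n sinz => cosy.
have : cos z * (cos z * z) <= cos z * (cos c * z).
  by rewrite ler_wpM2l // ler_wpM2r.
nra.
Qed.

Lemma sin_sqr_Dpi_int (R : realType) (x : R) (m : int) :
  sin (x + pi * m%:~R) ^+ 2 = sin x ^+ 2.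
Proof.
have nat_case (n : nat) y : sin (y + pi * n%:R : R) ^+ 2 = sin y ^+ 2.
  by rewrite mulr_natr (alternatingn (@sinDpi R)) exprMn sqrr_sign mul1r.
case: m => n; first exact: nat_case.
by rewrite NegzE mulrNz mulrN -[LHS](nat_case n.+1) subrK.
Qed.

(** [dist_int x <= |sin (pi x)|], read on inverse squares. Since 0 has inverse 0,
    the inequality at an integer [x] needs a separate check: both sides vanish. *)
Lemma sin_pi_inv_sqr_le (R : realType) (x : R) :
  sin (pi * x) ^- 2 <= dist_int x ^- 2.
Proof.
have [m _ dm] := dist_int_attained x.
have half := dist_int_le_half x; have d0 := dist_int_ge0 x.
have sind : sin (pi * x) ^+ 2 = sin (pi * dist_int x) ^+ 2.
  rewrite -[LHS](sin_sqr_Dpi_int _ (- m)) mulrNz mulrN -mulrBr dm.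
  by case: (ger0P (x - m%:~R)) => // _; rewrite mulrN sinN sqrrN.
rewrite sind; have [->|dn0] := eqVneq (dist_int x) 0.
  by rewrite mulr0 sin0 !expr0n.
have dp : 0 < dist_int x by rewrite lt_def dn0.
have pi2 := pi_ge2 R.
have dsin : dist_int x <= sin (pi * dist_int x).
  apply: le_trans (le_half_sin _); first by nra.
  by apply/andP; split; nra.
have sp : 0 < sin (pi * dist_int x) by apply: lt_le_trans dsin.
by rewrite lef_pV2 ?posrE ?exprn_gt0 // ler_pXn2r ?nnegrE // ltW.
Qed.

(** * Convergence of the two series *)

(** Localization to a bounded interval: over all of R the sets where the terms are
    large have infinite measure. *)
Lemma ae_int_cover (R : realType) (P : R -> Prop) :
  (forall j : int, {ae (@lebesgue_measure R), forall x,
      j%:~R <= x < (j + 1)%:~R -> P x}) ->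
  {ae (@lebesgue_measure R), forall x, P x}.
Proof.
move=> H.
have : {ae (@lebesgue_measure R), forall x, forall n : nat,
    let j : int := odflt 0 (unpickle n) in j%:~R <= x < (j + 1)%:~R -> P x}.
  by apply/ae_foralln => n; exact: H.
apply: filterS; first exact: (ae_filter_ringOfSetsType lebesgue_measure).
move=> x /(_ (pickle (Num.floor x))); rewrite pickleK /=.
by apply; exact: floor_itv.
Qed.

(** (n+1)^(-3/2), the distance at which [(n+1)^-3 * dist^-2] equals 1. *)
Definition critical_dist (R : realType) (n : nat) : R :=
  (n.+1%:R * Num.sqrt n.+1%:R)^-1.

Lemma critical_dist_gt0 (R : realType) n : 0 < critical_dist R n.
Proof. by rewrite invr_gt0 mulr_gt0 ?sqrtr_gt0 ?ltr0n. Qed.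

Lemma critical_dist_sqr (R : realType) n :
  critical_dist R n ^+ 2 = n.+1%:R ^- 3.
Proof. by rewrite exprVn exprMn sqr_sqrtr ?ler0n // -exprSr. Qed.

(** Comparison with the differences of [4 / sqrt (n+1)]. For a = sqrt (n+1) and
    b = sqrt (n+2) the constant 4 is enough because [(a + b) * b <= 4 * a^2]. *)
Lemma critical_dist_summable (R : realType) :
  (\sum_(n <oo) (critical_dist R n)%:E < +oo)%E.
Proof.
pose t n : R := 4 / Num.sqrt n.+1%:R.
apply: (@le_lt_trans _ _ (t 0)%:E); last exact: ltry.
apply: nneseries_le_telescope => n.
- exact/ltW/critical_dist_gt0.
- by rewrite /t divr_ge0 ?sqrtr_ge0.
rewrite /t /critical_dist; set a := Num.sqrt n.+1%:R; set b := Num.sqrt n.+2%:R.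
have a1 : 1 <= a by rewrite -sqrtr1 ler_sqrt ?ler0n ?ler1n.
have b0 : 0 < b by rewrite sqrtr_gt0 ltr0n.
have a2 : n.+1%:R = a ^+ 2 by rewrite sqr_sqrtr ?ler0n.
have b2 : b ^+ 2 = a ^+ 2 + 1 by rewrite !sqr_sqrtr ?ler0n // [LHS]mulrSr.
have a0 : 0 < a by lra.
rewrite a2 -subr_ge0.
have -> : 4 / a - 4 / b - (a ^+ 2 * a)^-1 =
    (4 * a ^+ 2 * (b - a) - b) / (a ^+ 3 * b).
  by field; rewrite !gt_eqF.
rewrite divr_ge0 ?mulr_ge0 ?exprn_ge0 ?(ltW a0) ?(ltW b0) //.
(* Multiplying by a + b removes the difference of square roots. *)
rewrite -(pmulr_rge0 _ (_ : 0 < a + b)) ?addr_gt0 //.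
have -> : (a + b) * (4 * a ^+ 2 * (b - a) - b) =
    4 * a ^+ 2 * (b ^+ 2 - a ^+ 2) - (b ^+ 2 + a * b) by ring.
rewrite b2; have := sqr_ge0 (b - a); nra.
Qed.

Lemma is_cvg_series_from1 (R : realType) (u : nat -> R) :
  cvgn (series (fun n => u n.+1)) ->
  cvgn (fun N : nat => \sum_(1 <= n < N) u n).
Proof.
have -> : series (fun n => u n.+1) = [sequence \sum_(1 <= n < N.+1) u n]_N.
  by apply/funext => N; rewrite /= big_add1.
by move=> /cvg_ex[l ul]; apply/cvg_ex; exists l; rewrite -cvg_shiftS.
Qed.

(** The constant 8 is the factor 4 of [lebesgue_measure_resonance_le] times the 2
    by which the layers of [dyadic_layer] start at [2 * s]. *)
Lemma ae_cvg_dist_int_series (R : realType) :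
  {ae (@lebesgue_measure R), forall x : R,
     cvgn (series (fun n => n.+1%:R ^- 3 * dist_int (n.+1%:R * x) ^- 2))}.
Proof.
apply: ae_int_cover => j.
apply: (@ae_cvg_series_weak_type _ _ R lebesgue_measure
  [set x | j%:~R <= x < (j + 1)%:~R]
  (fun n x => n.+1%:R ^- 3 * dist_int (n.+1%:R * x) ^- 2)
  (fun n => 8 * critical_dist R n)
  (fun n k => resonance j n.+1 (2 ^+ k.+1 * critical_dist R n))).
- by move=> n x; rewrite mulr_ge0 // invr_ge0 exprn_ge0 // dist_int_ge0.
- by move=> n; rewrite mulr_ge0 // ltW // critical_dist_gt0.
- under eq_eseriesr do rewrite EFinM.
  rewrite nneseriesZl => [|n _]; last by rewrite lee_fin ltW // critical_dist_gt0.
  by apply: lte_mul_pinfty; rewrite ?lee_fin // critical_dist_summable.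
- by move=> n k; exact: measurable_resonance.
- move=> n k; apply: le_trans (lebesgue_measure_resonance_le _ _ _) _ => //.
    by rewrite mulr_ge0 ?exprn_ge0 // ltW // critical_dist_gt0.
  by rewrite lee_fin exprS; lra.
- move=> n x /= jx.
  have [k dk fk] :=
    dyadic_layer (dist_int_ge0 (n.+1%:R * x)) (critical_dist_gt0 R n).
  by exists k; [exact: mem_resonance | rewrite -critical_dist_sqr].
Qed.

(* MathComp-Analysis. At a rational alpha some terms are inverses of 0, which
   the library sets to 0; the rationals are a null set, so this is harmless. *)
Theorem theorem7 (R : realType) :
  {ae (@lebesgue_measure R), forall alpha : R,
     cvgn (fun N : nat =>
       \sum_(1 <= n < N) n%:R ^- 3 * dist_int (n%:R * alpha) ^- 2)} /\
  {ae (@lebesgue_measure R), forall alpha : R,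
     cvgn (fun N : nat =>
       \sum_(1 <= n < N) n%:R ^- 3 * sin (pi * n%:R * alpha) ^- 2)}.
Proof.
split.
  apply: filterS (ae_cvg_dist_int_series R).
    exact: (ae_filter_ringOfSetsType lebesgue_measure).
  by move=> x; exact: is_cvg_series_from1.
apply: filterS (ae_cvg_dist_int_series R).
  exact: (ae_filter_ringOfSetsType lebesgue_measure).
move=> x cx; apply: is_cvg_series_from1; apply: series_le_cvg cx => n.
- by rewrite mulr_ge0 // invr_ge0 ?sqr_ge0 ?exprn_ge0.
- by rewrite mulr_ge0 // ?invr_ge0 ?exprn_ge0 // dist_int_ge0.
- by rewrite ler_wpM2l ?invr_ge0 ?exprn_ge0 // -mulrA sin_pi_inv_sqr_le.
Qed.
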